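(* Let $(V,\nu)$ be a fuzzy antinormed linear space with respect to a t-conorm $\diamond$, and assume: (a) for every $x\in V$, if $\nu(x,t)<1$ for all $t>0$ then $x=\theta$; (b) for every $x\in V$ with $x\neq\theta$, $\nu(x,\cdot)$ is continuous on $\mathbb{R}$ and strictly decreasing on the set $\{t\in\mathbb{R}:0<\nu(x,t)<1\}$; (c) $a\diamond a=a$ for all $a\in[0,1]$. Let $\alpha\in(0,1)$. If the set $\{x\in V:\nu(x,1)\le 1-\alpha\}$ is compact, then $V$ is finite dimensional.
   Context: $V$ is a linear space over $F$ ($F=\mathbb{R}$ or $\mathbb{C}$), and $\theta$ is its zero vector. A t-conorm is a map $\diamond:[0,1]\times[0,1]\to[0,1]$ that is commutative, associative, continuous, satisfies $a\diamond 0=a$ for all $a$, and satisfies $a\diamond b\le c\diamond d$ whenever $a\le c$, $b\le d$. A fuzzy antinorm on $V$ with respect to $\diamond$ is a function $\nu:V\times\mathbb{R}\to[0,1]$ such that for all $x,y\in V$: (i) $\nu(x,t)=1$ for all $t\le 0$; (ii) $\nu(x,t)=0$ for all $t>0$ if and only if $x=\theta$; (iii) $\nu(cx,t)=\nu(x,t/|c|)$ for all $t>0$ and $c\in F$, $c\ne 0$; (iv) $\nu(x+y,s+t)\le\nu(x,s)\diamond\nu(y,t)$ for all $s,t\in\mathbb{R}$; (v) $\lim_{t\to\infty}\nu(x,t)=0$. The pair $(V,\nu)$ is then called a fuzzy antinormed linear space with respect to $\diamond$. A sequence $(x_n)$ in $V$ converges to $x\in V$ if for every $t>0$ and $r\in(0,1)$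 there is $n_0\in\mathbb{N}$ with $\nu(x_n-x,t)<r$ for all $n\ge n_0$. A subset $A\subseteq V$ is compact if every sequence in $A$ has a subsequence converging (in this sense) to an element of $A$. *)

(* Defs.v *)
From HB Require Import structures.
From mathcomp Require Import all_boot all_order all_algebra.
From mathcomp Require Import all_classical all_reals all_analysis.
From mathcomp.real_closed Require Import complex.
Set Implicit Arguments.
Unset Strict Implicit.
Unset Printing Implicit Defensive.
Import Order.TTheory GRing.Theory Num.Theory.
Import numFieldNormedType.Exports.
Local Open Scope classical_set_scope.
Local Open Scope ring_scope.

Inductive scalar_kind := RealScalars | ComplexScalars.

Definition scalar_field (R : realType) (k : scalar_kind) : fieldType :=
  match k with
  | RealScalars => R
  | ComplexScalars => R[i]
  end.

(* The modulus, with values in R: the norm `|z| of z : R[i] has type R[i]. *)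
Definition scalar_abs (R : realType) (k : scalar_kind) :
    scalar_field R k -> R :=
  match k return scalar_field R k -> R with
  | RealScalars => fun c : R => `|c|
  | ComplexScalars => fun c : R[i] => ComplexField.Normc.normc c
  end.
Arguments scalar_abs {R k}.

(* A binary operation on [0, 1] is a function on R whose values outside
   [0, 1] x [0, 1] are irrelevant. *)
Record is_t_conorm (R : realType) (D : R -> R -> R) : Prop := {
  t_conorm_itv : forall a b, a \in `[0, 1] -> b \in `[0, 1] ->
    D a b \in `[0, 1];
  t_conormC : forall a b, a \in `[0, 1] -> b \in `[0, 1] -> D a b = D b a;
  t_conormA : forall a b c,
    a \in `[0, 1] -> b \in `[0, 1] -> c \in `[0, 1] ->
    D a (D b c) = D (D a b) c;
  t_conorm_continuous :
    {within `[0, 1]%classic `*` `[0, 1]%classic,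
      continuous (fun p : R * R => D p.1 p.2)};
  t_conorm0 : forall a, a \in `[0, 1] -> D a 0 = a;
  t_conorm_le : forall a b c d,
    a \in `[0, 1] -> b \in `[0, 1] -> c \in `[0, 1] -> d \in `[0, 1] ->
    a <= c -> b <= d -> D a b <= D c d
}.

Record is_fuzzy_antinorm (R : realType) (k : scalar_kind)
    (V : lmodType (scalar_field R k)) (D : R -> R -> R)
    (nu : V -> R -> R) : Prop := {
  antinorm_itv : forall x t, nu x t \in `[0, 1];
  antinorm_le0 : forall x t, t <= 0 -> nu x t = 1;
  antinorm_eq0 : forall x, (forall t, 0 < t -> nu x t = 0) <-> x = 0;
  antinormZ : forall x t (c : scalar_field R k), 0 < t -> c != 0 ->
    nu (c *: x) t = nu x (t / scalar_abs c);
  antinormD : forall x y s t, nu (x + y) (s + t) <= D (nu x s) (nu y t);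
  antinorm_cvg0 : forall x, nu x t @[t --> +oo] --> (0 : R)
}.

Section convergence.
Variables (R : realType) (k : scalar_kind) (V : lmodType (scalar_field R k)).
Variable nu : V -> R -> R.

Definition fuzzy_cvg (u : nat -> V) (x : V) : Prop :=
  forall t r : R, 0 < t -> 0 < r < 1 ->
    exists n0 : nat, forall n, (n0 <= n)%N -> nu (u n - x) t < r.

Definition fuzzy_compact (A : set V) : Prop :=
  forall u : nat -> V, (forall n, A (u n)) ->
    exists phi : nat -> nat, {homo phi : m n / (m < n)%N} /\
      exists2 x, A x & fuzzy_cvg (u \o phi) x.

End convergence.

(* [Vector.axiom n V] lives in Type: it is the data of a linear bijection from
   V onto the row vectors of length n. *)
Definition finite_dimensional (F : fieldType) (V : lmodType F) : Prop :=
  exists n : nat, inhabited (Vector.axiom n V).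

(* Main.v *)
Require Import Defs.
From HB Require Import structures.
From mathcomp Require Import all_boot all_order all_algebra.
From mathcomp Require Import all_classical all_reals all_analysis.
From mathcomp.real_closed Require Import complex.
From mathcomp Require Import ring lra.
Set Implicit Arguments.
Unset Strict Implicit.
Unset Printing Implicit Defensive.
Import Order.TTheory GRing.Theory Num.Theory.
Import numFieldNormedType.Exports.
Local Open Scope classical_set_scope.
Local Open Scope ring_scope.

(** Since [D a a = a], the t-conorm is bounded by [Num.max], so [nu] satisfies
    the inequality
    [nu (x + y) (s + t) <= Num.max (nu x s) (nu y t)].  With [c = 1 - alpha],
    the gauge [inf {t > 0 | nu x t <= c}] is therefore a genuine norm:
    subadditivity is the inequality above, and definiteness is the assumption
    that a nonzero vector has [nu x t = 1] for some [t > 0].  Its open unit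
    ball lies in the compact set [{x | nu x 1 <= c}], and fuzzy convergence
    implies convergence for the gauge, so every sequence in the open unit ball
    has two terms that are close to each other
    ([compact_level_gauge_close]).

    The theorem thus reduces to Riesz's theorem for a norm
    ([riesz_spanning]).  The latter is proved for real scalars only: a complex
    space is also a real one, the gauge is a norm on it too, and a list that
    spans over the reals spans over the complex numbers.  Riesz's argument
    needs finite spans to be closed ([lin_span_closed]).  This is proved by
    adding one vector at a time, in the manner of the Hahn-Banach theorem: the
    new coefficient is a supremum of explicit lower bounds, so that neither
    sequences nor the equivalence of norms in finite dimension enter. *)

(** * Finite spans *)

(** A recursive form, available in infinite dimension, that suits proofs adding
    one vector at a time. *)
Fixpoint lin_span (F : fieldType) (V : lmodType F) (s : seq V) : set V :=
  if s is e :: s' then [set x | exists c : F, lin_span s' (x - c *: e)]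
  else [set 0].

Section span.
Variables (F : fieldType) (V : lmodType F).
Implicit Types (s : seq V) (x y e : V).

Lemma lin_span0 s : lin_span s 0.
Proof.
by elim: s => [//|e s ih] /=; exists 0; rewrite scale0r subr0.
Qed.

Lemma lin_spanD s x y : lin_span s x -> lin_span s y -> lin_span s (x + y).
Proof.
elim: s x y => [|e s ih] x y /=; first by move=> -> ->; rewrite addr0.
move=> [a xa] [b yb]; exists (a + b).
by rewrite scalerDl opprD addrACA; apply: ih.
Qed.

Lemma lin_spanZ s (a : F) x : lin_span s x -> lin_span s (a *: x).
Proof.
elim: s x => [|e s ih] x /=; first by move=> ->; rewrite scaler0.
by move=> [b xb]; exists (a * b); rewrite -scalerA -scalerBr; apply: ih.
Qed.

Lemma lin_span_behead s e x : lin_span s x -> lin_span (e :: s) x.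
Proof. by exists 0; rewrite scale0r subr0. Qed.

Lemma lin_span_head s e : lin_span (e :: s) e.
Proof. by exists 1; rewrite scale1r subrr; apply: lin_span0. Qed.

Lemma lin_span_absorb s e x :
  lin_span s e -> lin_span (e :: s) x -> lin_span s x.
Proof.
move=> se [c sx]; rewrite -(subrK (c *: e) x).
exact/lin_spanD/lin_spanZ.
Qed.

(** Discarding each vector that lies in the span of the later ones leaves a
    basis; its coordinates are the row vectors. *)
Lemma lin_span_coordinates s :
  exists n (f : 'rV[F]_n -> V), [/\ linear f, injective f &
    forall x, lin_span s x <-> exists r, f r = x].
Proof.
elim: s => [|e s [n [f [flin finj fspan]]]].
  exists 0%N, (fun=> 0); split=> [a u v|u v _|x].
  - by rewrite scaler0 addr0.
  - by rewrite [u]thinmx0 [v]thinmx0.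
  - by split=> [->|[_ <-//]]; exists 0.
have [se|se] := pselect (lin_span s e).
  exists n, f; split=> // x; rewrite -fspan.
  by split; [apply: lin_span_absorb | apply: lin_span_behead].
pose g (r : 'rV[F]_(1 + n)) : V := r 0 (lshift n 0) *: e + f (rsubmx r).
have fB u v : f (u - v) = f u - f v.
  by rewrite -[in LHS](scaleN1r v) [in LHS]addrC flin scaleN1r addrC.
exists (1 + n)%N, g; split=> [a u v|u v guv|x].
- rewrite /g; have -> : rsubmx (a *: u + v) = a *: rsubmx u + rsubmx v.
    by apply/rowP => i; rewrite !mxE.
  by rewrite flin !mxE scalerDr scalerDl -scalerA addrACA.
- have dv : (v 0 (lshift n 0) - u 0 (lshift n 0)) *: e = f (rsubmx u - rsubmx v).
    rewrite fB scalerBl; apply/eqP; rewrite subr_eq addrAC eq_sym subr_eq.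
    by rewrite [f _ + _]addrC; apply/eqP.
  have uv0 : u 0 (lshift n 0) = v 0 (lshift n 0).
    apply/eqP; rewrite eq_sym -subr_eq0; apply/negP => /negP nz; apply: se.
    rewrite -(scalerK nz e) dv; apply: lin_spanZ; rewrite fspan.
    by eexists.
  move: guv; rewrite /g uv0 => /addrI/finj uvr.
  rewrite -[u]hsubmxK -[v]hsubmxK uvr; congr row_mx.
  by apply/rowP => i; rewrite !mxE !ord1 uv0.
- split=> [[c /fspan [r fr]]|[r <-]].
    exists (row_mx (c%:M : 'M[F]_1) r); rewrite /g row_mxKr fr.
    by rewrite row_mxEl mxE eqxx mulr1n addrC subrK.
  exists (r 0 (lshift n 0)); rewrite /g addrAC subrr add0r; apply/fspan.
  by eexists.
Qed.

Lemma finite_dimensional_lin_span s :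
  (forall x, lin_span s x) -> finite_dimensional V.
Proof.
have [n [f [flin finj fspan]]] := lin_span_coordinates s => sV.
have /choice [g fg] : forall x, exists r, f r = x by move=> x; apply/fspan.
have gf : cancel f g by move=> r; apply: finj; rewrite fg.
exists n; constructor; exists g; last by exists f.
by move=> a u v; apply: finj; rewrite flin !fg.
Qed.

End span.

(** * Riesz's theorem *)

Record is_vector_norm (R : realType) (V : lmodType R) (N : V -> R) : Prop := {
  vnorm_gt0 : forall x, x != 0 -> 0 < N x;
  vnormD : forall x y, N (x + y) <= N x + N y;
  vnormZ : forall (c : R) x, N (c *: x) = `|c| * N x
}.

Section riesz.
Variables (R : realType) (V : lmodType R) (N : V -> R).
Hypothesis normN : is_vector_norm N.
Implicit Types (s : seq V) (x y e : V).

Let ND := vnormD normN.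
Let NZ := vnormZ normN.

Lemma vnorm_ge0 x : 0 <= N x.
Proof.
have [->|/(vnorm_gt0 normN)/ltW//] := eqVneq x 0.
by rewrite -(scale0r (0 : V)) NZ normr0 mul0r.
Qed.

Lemma vnormN x : N (- x) = N x.
Proof. by rewrite -scaleN1r NZ normrN1 mul1r. Qed.

(** A vector [e] at distance [d] from a subspace satisfies
    [`|c| * d <= N (c *: e - y)], so [`|c - c'| * d] is at most
    [N (x - c *: e - y) + N (x - c' *: e - y')].  Hence the numbers
    [c - N (x - c *: e - y) / d] all lie below the numbers
    [c' + N (x - c' *: e - y') / d], and completeness of the reals supplies
    a coefficient [c0] between the two families. *)
Lemma best_coefficient s e x (d : R) : 0 < d ->
    (forall y, lin_span s y -> d <= N (e - y)) ->
  exists c0 : R, forall c y, lin_span s y ->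
    `|c - c0| * d <= N (x - c *: e - y).
Proof.
move=> d0 de.
have dZ c y : lin_span s y -> `|c| * d <= N (c *: e - y).
  have [->|c0] := eqVneq c 0; first by rewrite normr0 mul0r vnorm_ge0.
  move=> sy; rewrite (_ : c *: e - y = c *: (e - c^-1 *: y)).
    by rewrite NZ ler_pM2l ?normr_gt0// de//; apply: lin_spanZ.
  by rewrite scalerBr scalerA mulfV// scale1r.
pose A := [set a : R | exists c y, lin_span s y /\
  a = c - N (x - c *: e - y) / d].
have A0 : A !=set0.
  by eexists; exists 0, 0; split; [apply: lin_span0|].
have uA c y : lin_span s y -> ubound A (c + N (x - c *: e - y) / d).
  move=> sy _ [c' [y' [sy' ->]]].
  rewrite lerBlDr -addrA -lerBlDl -mulrDl ler_pdivlMr//.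
  apply: (@le_trans _ _ (`|c' - c| * d)).
    by rewrite ler_pM2r// ler_norm.
  have /(dZ (c' - c))/le_trans : lin_span s (y - y').
    by rewrite -scaleN1r; apply/lin_spanD/lin_spanZ.
  apply; rewrite -[N (x - c' *: _ - _)]vnormN.
  apply: le_trans (ND _ _); rewrite le_eqVlt; apply/orP; left; apply/eqP.
  congr N; rewrite scalerBl !opprD !opprK.
  rewrite [RHS]addrACA [X in _ = X + _]addrACA subrr add0r.
  by rewrite [- (_ *: _) + _]addrC.
exists (sup A) => c y sy; rewrite -ler_pdivlMr// ler_norml.
apply/andP; split.
  by rewrite lerBrDl lerBlDr; apply: ge_sup (uA _ _ sy).
rewrite lerBlDr addrC -lerBlDr; apply: ub_le_sup; last by exists c, y.
by eexists; apply: (uA 0 0); apply: lin_span0.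
Qed.

(** Finite spans are closed.  When [e] is far from the span of [s] and [c0] is
    the coefficient above, [x - c0 *: e] is at positive distance from that
    span, and replacing [c0] by another coefficient [c] costs at most
    [`|c - c0| * N e <= N e / d * N (x - c *: e - y)]. *)
Lemma lin_span_closed s x : ~ lin_span s x ->
  exists2 d, 0 < d & forall y, lin_span s y -> d <= N (x - y).
Proof.
elim: s x => [|e s ih] x sx.
  exists (N x) => [|y ->]; last by rewrite subr0.
  by apply: (vnorm_gt0 normN); apply/eqP.
have [se|/ih[d d0 de]] := pselect (lin_span s e).
  have [|d d0 dx] := ih x; first by move=> /(@lin_span_behead _ _ _ e).
  by exists d => // y /(lin_span_absorb se)/dx.
have [c0 c0P] := best_coefficient x d0 de.
have [|r r0 rx] := ih (x - c0 *: e); first by move=> ?; apply: sx; exists c0.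
have K0 : 0 < 1 + N e / d.
  by rewrite ltr_pwDl// divr_ge0 ?vnorm_ge0// ltW.
exists (r / (1 + N e / d)) => [|z [c sz]]; first by rewrite divr_gt0.
rewrite ler_pdivrMr// mulrDr mulr1.
have /rx/le_trans := sz; apply.
have -> : x - c0 *: e - (z - c *: e) = (x - z) + (c - c0) *: e.
  rewrite opprB scalerBl addrACA [RHS]addrACA; congr (_ + _).
  by rewrite addrC.
apply: le_trans (ND _ _) _; rewrite lerD2l NZ.
have := c0P c _ sz; rewrite opprB addrA subrK -ler_pdivlMr// => cc0.
by rewrite [leRHS]mulrA [leRHS]mulrAC; apply: ler_wpM2r cc0; apply: vnorm_ge0.
Qed.

(** Riesz's lemma; the factor 2 is slack, as the distance to a subspace need
    not be attained. *)
Lemma riesz_separation s x : ~ lin_span s x ->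
  exists2 u, N u < 1 & forall y, lin_span s y -> 2^-1 <= N (u - y).
Proof.
move=> sx; have [d d0 dx] := lin_span_closed sx.
pose E := [set r : R | exists2 y, lin_span s y & r = N (x - y)].
have E0 : E !=set0 by eexists; exists 0; [apply: lin_span0|].
have dE : d <= inf E by apply: lb_le_inf => // _ [y sy ->]; apply: dx.
have iE0 := lt_le_trans d0 dE; have iE2 : 0 < 2 * inf E by rewrite mulr_gt0.
have iE20 : 0 <= (2 * inf E)^-1 by rewrite invr_ge0 ltW.
have [|_ [y0 sy0 ->] ny0] := @inf_lt _ E (2 * inf E) E0; first by lra.
exists ((2 * inf E)^-1 *: (x - y0)) => [|y sy].
  by rewrite NZ (ger0_norm iE20) ltr_pdivrMl// mulr1.
have -> : (2 * inf E)^-1 *: (x - y0) - y =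
    (2 * inf E)^-1 *: (x - (y0 + (2 * inf E) *: y)).
  by rewrite opprD addrA [RHS]scalerBr scalerA mulVf ?scale1r// gt_eqF.
rewrite NZ (ger0_norm iE20) ler_pdivlMl//.
rewrite mulrAC mulfV ?mul1r; last by rewrite pnatr_eq0.
apply: ge_inf; first by exists 0 => _ [z _ ->]; apply: vnorm_ge0.
by eexists; [apply: (lin_spanD sy0 (lin_spanZ (2 * inf E) sy))|].
Qed.

(** If no finite list spans, a sequence is chosen in the open unit ball, each
    term at distance at least 1/2 from the span of the previous ones; this
    contradicts the hypothesis, a weak form of total boundedness. *)
Lemma riesz_spanning :
    (forall u : nat -> V, (forall n, N (u n) < 1) ->
       exists m n, (m < n)%N /\ N (u n - u m) < 2^-1) ->
  exists s, forall x, lin_span s x.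
Proof.
move=> tb; apply: contrapT => nspan.
have sep s : exists u, N u < 1 /\ forall y, lin_span s y -> 2^-1 <= N (u - y).
  have [x sx] : exists x, ~ lin_span s x.
    by apply/existsNP => sV; apply: nspan; exists s.
  by have [u] := riesz_separation sx; exists u.
have [next nextP] := choice sep.
pose prefix n := iter n (fun s => next s :: s) [::].
have prefix_span m n : (m < n)%N -> lin_span (prefix n) (next (prefix m)).
  elim: n => [//|n ih]; rewrite ltnS leq_eqVlt => /predU1P[->|/ih].
    exact: lin_span_head.
  exact: lin_span_behead.
have [//|m [n [/prefix_span mn]]] := tb (fun n => next (prefix n)).
  by move=> n; have [] := nextP (prefix n).
by have [_ /(_ _ mn)] := nextP (prefix n); rewrite leNgt => /negP.
Qed.

End riesz.

(** * The gauge of a level set *)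

Section gauge.
Variables (R : realType) (V : lmodType R) (D : R -> R -> R) (nu : V -> R -> R).
Hypotheses (hD : is_t_conorm D)
  (hnu : @is_fuzzy_antinorm R RealScalars V D nu)
  (hc : forall a : R, a \in `[0, 1] -> D a a = a).
Variable c : R.
Hypotheses (c0 : 0 < c) (c1 : c < 1).

(** An idempotent t-conorm is at most [Num.max], which is all that the
    triangle inequality requires. *)
Lemma antinormD_max x y s t : nu (x + y) (s + t) <= Num.max (nu x s) (nu y t).
Proof.
have xI := antinorm_itv hnu x s; have yI := antinorm_itv hnu y t.
have mI : Num.max (nu x s) (nu y t) \in `[0, 1] by case: leP.
apply: le_trans (antinormD hnu _ _ _ _) _; rewrite -[leRHS](hc mI).
by apply: (t_conorm_le hD) => //; rewrite le_max lexx ?orbT.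
Qed.

Lemma antinorm_nonincreasing x s t : s <= t -> nu x t <= nu x s.
Proof.
rewrite le_eqVlt => /predU1P[->//|st].
have := antinormD_max x 0 s (t - s); rewrite addr0 addrC subrK.
rewrite (antinorm_eq0 hnu 0).2// ?subr_gt0// max_l//.
by have := antinorm_itv hnu x s; rewrite in_itv => /andP[].
Qed.

Definition gauge (x : V) : R := inf [set t | 0 < t /\ nu x t <= c].

Let has_lb x : has_lbound [set t | 0 < t /\ nu x t <= c].
Proof. by exists 0 => t [/ltW]. Qed.

Let level_neq0 x : [set t | 0 < t /\ nu x t <= c] !=set0.
Proof.
have nu0 := antinorm_cvg0 hnu x.
have t_gt0 := nbhs_pinfty_gt (num_real (0 : R)).
have [t [tc t0]] := filter_ex (filterI (cvgr_lt _ nu0 _ c0) t_gt0).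
by exists t; split=> //; apply: ltW.
Qed.

Lemma gauge_le x t : 0 < t -> nu x t <= c -> gauge x <= t.
Proof. by move=> t0 xt; apply: ge_inf. Qed.

Lemma gauge_lt x t : gauge x < t -> nu x t <= c.
Proof.
move=> /(inf_lt (level_neq0 x))[s [_ xs] st].
exact: le_trans (antinorm_nonincreasing x (ltW st)) xs.
Qed.

Lemma gauge_ge0 x : 0 <= gauge x.
Proof. by apply: lb_le_inf => // t [/ltW]. Qed.

(** A nonzero vector has [nu x t = 1] for some [t > 0]; as [c < 1], such a [t]
    bounds the gauge from below. *)
Lemma gauge_gt0 (ha : forall x : V, (forall t, 0 < t -> nu x t < 1) -> x = 0)
  x : x != 0 -> 0 < gauge x.
Proof.
move=> x0; have [t t0 xt] : exists2 t, 0 < t & 1 <= nu x t.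
  apply: contrapT => nt; move/eqP: x0; apply; apply: ha => t t0.
  by rewrite ltNge; apply/negP => xt; apply: nt; exists t.
apply: lt_le_trans t0 _; apply: lb_le_inf => // s [s0 xs].
rewrite leNgt; apply/negP => /ltW/(antinorm_nonincreasing x).
by move=> /(le_trans xt)/le_trans/(_ xs); rewrite leNgt c1.
Qed.

Lemma gaugeD x y : gauge (x + y) <= gauge x + gauge y.
Proof.
apply/ler_addgt0Pr => e e0; have e20 : 0 < e / 2 by rewrite divr_gt0.
have gx := gauge_ge0 x; have gy := gauge_ge0 y.
rewrite (_ : _ + e = (gauge x + e / 2) + (gauge y + e / 2)); last by field.
apply: gauge_le; first lra.
apply: le_trans (antinormD_max _ _ _ _) _.
by rewrite ge_max !gauge_lt// ltrDl.
Qed.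

Lemma gaugeZ (a : R) x : gauge (a *: x) = `|a| * gauge x.
Proof.
have leZ (b : R) y : b != 0 -> gauge (b *: y) <= `|b| * gauge y.
  move=> b0; have nb0 : 0 < `|b| by rewrite normr_gt0.
  rewrite -ler_pdivrMl//; apply/ler_addgt0Pr => e e0.
  have ye0 : 0 < gauge y + e by rewrite ltr_wpDl// gauge_ge0.
  rewrite ler_pdivrMl//; apply: gauge_le; first exact: mulr_gt0.
  rewrite (antinormZ hnu)//= ?mulr_gt0// mulrAC mulfV ?mul1r ?gt_eqF//.
  by apply: gauge_lt; rewrite ltrDl.
have [->|a0] := eqVneq a 0.
  rewrite scale0r normr0 mul0r; apply/eqP; rewrite eq_le gauge_ge0 andbT.
  apply/ler_addgt0Pr => e e0; rewrite add0r; apply: gauge_le => //.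
  by rewrite (antinorm_eq0 hnu 0).2// ltW.
apply/eqP; rewrite eq_le leZ//= -ler_pdivlMl ?normr_gt0//.
by rewrite -normfV -[in leLHS](scalerK a0 x) leZ ?invr_eq0.
Qed.

Lemma gauge_is_vector_norm
    (ha : forall x : V, (forall t, 0 < t -> nu x t < 1) -> x = 0) :
  is_vector_norm gauge.
Proof. by split; [apply: gauge_gt0 | apply: gaugeD | apply: gaugeZ]. Qed.

(** Fuzzy convergence tested at the level [r = c] is convergence for the gauge,
    so two late terms of a convergent subsequence are close to each other. *)
Lemma compact_level_gauge_close (e : R) (u : nat -> V) : 0 < e ->
    fuzzy_compact (k := RealScalars) nu [set x | nu x 1 <= c] ->
    (forall n, gauge (u n) < 1) ->
  exists m n, (m < n)%N /\ gauge (u n - u m) < e.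
Proof.
move=> e0 cpt u1; have [n|phi [phi_lt [x _ ux]]] := cpt u.
  exact: gauge_lt.
have e30 : 0 < e / 3 by rewrite divr_gt0.
have [|n0 n0P] := ux (e / 3) c e30; first by rewrite c0.
have near n : (n0 <= n)%N -> gauge (u (phi n) - x) <= e / 3.
  by move=> /n0P/ltW; apply: gauge_le.
exists (phi n0), (phi n0.+1); split; first exact: phi_lt.
rewrite (_ : _ - _ = (u (phi n0.+1) - x) + (-1) *: (u (phi n0) - x)); last first.
  by rewrite scaleN1r opprB addrA subrK.
apply: le_lt_trans (gaugeD _ _) _; rewrite gaugeZ normrN1 mul1r.
have := near n0 (leqnn _); have := near n0.+1 (leqnSn _); lra.
Qed.

End gauge.

(** * Restriction of scalars *)

(** An alias of [V], so that the module structure over the smaller field does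
    not clash with the given one. *)
Definition restrict_scalars (K F : fieldType) (iota : {rmorphism K -> F})
  (V : lmodType F) : Type := V.

Section restrict_scalars.
Variables (K F : fieldType) (iota : {rmorphism K -> F}) (V : lmodType F).

HB.instance Definition _ :=
  GRing.Zmodule.on (restrict_scalars iota V).

Let rscale (a : K) (x : restrict_scalars iota V) : restrict_scalars iota V :=
  iota a *: (x : V).

Let rscaleA a b x : rscale a (rscale b x) = rscale (a * b) x.
Proof. by rewrite /rscale scalerA rmorphM. Qed.

Let rscale1 : left_id 1 rscale.
Proof. by move=> x; rewrite /rscale rmorph1 scale1r. Qed.

Let rscaleDr : right_distributive rscale +%R.
Proof. by move=> a x y; rewrite /rscale scalerDr. Qed.

Let rscaleDl x : {morph rscale^~ x : a b / a + b}.
Proof. by move=> a b; rewrite /rscale rmorphD scalerDl. Qed.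

HB.instance Definition _ :=
  GRing.Zmodule_isLmodule.Build K (restrict_scalars iota V)
    rscaleA rscale1 rscaleDr rscaleDl.

Lemma restrict_scalarsE a (x : restrict_scalars iota V) :
  a *: x = iota a *: (x : V).
Proof. by []. Qed.

Lemma lin_span_restrict_scalars s (x : restrict_scalars iota V) :
  lin_span s x -> lin_span (s : seq V) (x : V).
Proof.
by elim: s x => [//|e s ih] x [a /ih ?]; exists (iota a).
Qed.

End restrict_scalars.

Definition real_scalar (R : realType) (k : scalar_kind) :
    {rmorphism R -> scalar_field R k} :=
  match k return {rmorphism R -> scalar_field R k} with
  | RealScalars => idfun
  | ComplexScalars => real_complex R
  end.

Lemma scalar_abs_real (R : realType) (k : scalar_kind) (a : R) :
  scalar_abs (real_scalar R k a) = `|a|.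
Proof. by case: k => //=; rewrite expr0n addr0 sqrtr_sqr. Qed.

Lemma is_fuzzy_antinorm_restrict_scalars (R : realType) (k : scalar_kind)
    (V : lmodType (scalar_field R k)) (D : R -> R -> R) (nu : V -> R -> R) :
  is_fuzzy_antinorm D nu ->
  @is_fuzzy_antinorm R RealScalars (restrict_scalars (real_scalar R k) V) D nu.
Proof.
case=> nuI nu_le0 nu0 nuZ nuD nu_cvg; split=> // x t a t0 a0.
by rewrite restrict_scalarsE nuZ ?fmorph_eq0// scalar_abs_real.
Qed.

(** * A compact level set forces finite dimension *)

Theorem theorem3p20 (R : realType) (k : scalar_kind)
    (V : lmodType (scalar_field R k)) (D : R -> R -> R) (nu : V -> R -> R)
    (hD : is_t_conorm D) (hnu : is_fuzzy_antinorm D nu)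
    (ha : forall x : V, (forall t : R, 0 < t -> nu x t < 1) -> x = 0)
    (hb_cont : forall x : V, x != 0 -> continuous (nu x))
    (hb_decr : forall x : V, x != 0 ->
      forall s t : R, 0 < nu x s < 1 -> 0 < nu x t < 1 ->
        s < t -> nu x t < nu x s)
    (hc : forall a : R, a \in `[0, 1] -> D a a = a)
    (alpha : R) (halpha : 0 < alpha < 1)
    (hcompact : fuzzy_compact nu [set x : V | nu x 1 <= 1 - alpha]) :
  finite_dimensional V.
Proof.
have /andP[a0 a1] := halpha.
have c0 : 0 < 1 - alpha by rewrite subr_gt0.
have c1 : 1 - alpha < 1 by rewrite ltrBlDr ltrDl.
pose W := restrict_scalars (real_scalar R k) V.
have hW : @is_fuzzy_antinorm R RealScalars W D nu.
  exact: is_fuzzy_antinorm_restrict_scalars.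
have normN : is_vector_norm (gauge (V := W) nu (1 - alpha)).
  exact: (gauge_is_vector_norm hD hW hc c0 c1 ha).
have [u u1|s sV] := riesz_spanning normN.
  by apply: (compact_level_gauge_close hD hW hc c0 c1 _ hcompact u1); lra.
apply: (@finite_dimensional_lin_span _ V s) => x.
exact: (lin_span_restrict_scalars (sV x)).
Qed.
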